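(* Any affine LR system $(L,G,\mathcal{M}=Z+\mathcal{D})$ has the conserved moving energy $E_{L,Z}|_M$.
   Context: All objects are smooth. The configuration manifold is a Lie group $G$ of dimension $n$. The Lagrangian $L:TG\to\mathbb{R}$ has the form $L=T+b-V\circ\pi$, with $T$ the kinetic energy of a Riemannian metric on $G$, $b$ a 1-form on $G$ regarded as a function on $TG$, $V$ a function on $G$, and $\pi:TG\to G$ the projection. $L$ is left-invariant if it is invariant under the tangent lift to $TG$ of every left translation of $G$. $\mathcal{D}$ is a nonintegrable distribution on $G$ of constant rank $r$, $1<r<n$, and $Z$ is a vector field on $G$. The affine constraint distribution $\mathcal{M}=Z+\mathcal{D}$ has fibers $\mathcal{M}_g=Z(g)+\mathcal{D}_g\subset T_gG$; the submanifold $M\subset TG$ with these fibers is the constraint manifold. An affine LR system is a nonholonomic system with affine constraints $(L,G,\mathcal{M}=Z+\mathcal{D})$ in which the Lagrangian $L$ is left-invariant and both $Z$ and $\mathcal{D}$ are right-invariant: $(\mathrm{R}_g)_*Z=Z$ and $\mathcal{D}_g=T_e\mathrm{R}_g\cdot\mathcal{D}_e$ for all $g\in G$, with $\mathrm{R}_g$ right translation by $g$ and $e$ the identity. The constraint is ideal (d'Alembert): in local coordinates $(q,\dot q)$ of $TG$ the equations of motion are the restriction to $M$ of $\frac{d}{dt}\frac{\partial L}{\partial\dot q}-\frac{\partial L}{\partial q}=R$, where $R:M\to\mathcal{D}^\circ$ (fiberwise, with values in the annihilator of $\mathcal{D}$) is the unique such function (the reaction force) for which these equations define a dynamics on $M$.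 A function on $M$ is conserved if it is constant along all solutions of the equations of motion. $p$ is the momentum 1-form generated by $L$ (in coordinates $p=\partial L/\partial\dot q$), $E_L:=\langle p,\cdot\rangle-L$, and for a vector field $Y$ on $G$, $E_{L,Y}:=E_L-\langle p,Y\rangle$, as functions on $TG$. A moving energy is a function on $M$ of the form $E_{L,Y}|_M$. *)

(* Defs.v *)
From HB Require Import structures.
From mathcomp Require Import all_boot all_order all_algebra.
From mathcomp Require Import boolp classical_sets reals topology normedtype.
From mathcomp Require Import derive.

Set Implicit Arguments.
Unset Strict Implicit.
Unset Printing Implicit Defensive.

Import Order.TTheory GRing.Theory Num.Theory.
Import numFieldNormedType.Exports.

Local Open Scope classical_set_scope.
Local Open Scope ring_scope.

(* C^oo on an open set U of a finite-dimensional space: every iterated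
   directional derivative is (Frechet) differentiable at every point of U. *)
Definition smooth_on (R : realType) (V W : normedModType R) (U : set V)
    (f : V -> W) : Prop :=
  forall (vs : seq V) (x : V), U x ->
    differentiable (foldr (fun v g => fun y => 'D_v g y) f vs) x.

(* A chart is a homeomorphism from the open set chart_dom onto the open set
   chart_cod; the values of the two maps elsewhere are irrelevant. *)
Record chart (R : realType) (n : nat) (M : topologicalType) := Chart {
  chart_dom : set M;
  chart_cod : set 'rV[R]_n;
  chart_map :> M -> 'rV[R]_n;
  chart_inv : 'rV[R]_n -> M;
  chart_dom_open : open chart_dom;
  chart_cod_open : open chart_cod;
  chart_map_cod : forall q, chart_dom q -> chart_cod (chart_map q);
  chart_inv_dom : forall x, chart_cod x -> chart_dom (chart_inv x);
  chart_mapK : forall q, chart_dom q -> chart_inv (chart_map q) = q;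
  chart_invK : forall x, chart_cod x -> chart_map (chart_inv x) = x;
  chart_map_continuous :
    forall q, chart_dom q -> {for q, continuous chart_map};
  chart_inv_continuous :
    forall x, chart_cod x -> {for x, continuous chart_inv}
}.

(* The atlas need not be maximal.  The preferred chart chart_at q serves to
   identify the tangent space at q with 'rV[R]_n, see below. *)
HB.mixin Record isSmoothManifold (R : realType) (n : nat) M
    of Topological M := {
  atlas : set (chart R n M);
  chart_at : M -> chart R n M;
  chart_at_atlas : forall q : M, atlas (chart_at q);
  chart_at_dom : forall q : M, chart_dom (chart_at q) q;
  atlas_compatible : forall phi psi : chart R n M, atlas phi -> atlas psi ->
    smooth_on (chart_cod phi `&` chart_inv phi @^-1` chart_dom psi)
              (psi \o chart_inv phi);
  manifold_hausdorff : hausdorff_space M;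
  manifold_second_countable : @second_countable M
}.

#[short(type="smoothManifoldType")]
HB.structure Definition SmoothManifold (R : realType) (n : nat) :=
  { M of Topological M & isSmoothManifold R n M }.

Arguments atlas {R n s}.
Arguments chart_at {R n s}.

Definition smooth_into (R : realType) (n : nat) (M : smoothManifoldType R n)
    (V : normedModType R) (U : set V) (f : V -> M) : Prop :=
  (forall x, U x -> {for x, continuous f}) /\
  (forall phi : chart R n M, atlas phi ->
     smooth_on (U `&` f @^-1` chart_dom phi) (phi \o f)).

HB.mixin Record isLieGroup (R : realType) (n : nat) G
    of SmoothManifold R n G & Group G := {
  mulg_continuous : continuous (fun p : G * G => (p.1 * p.2)%g);
  mulg_smooth : forall phi psi : chart R n G, atlas phi -> atlas psi ->
    smooth_into (chart_cod phi `*` chart_cod psi)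
      (fun p : 'rV[R]_n * 'rV[R]_n =>
         (chart_inv phi p.1 * chart_inv psi p.2)%g : G);
  invg_continuous : continuous (fun q : G => (q^-1)%g);
  invg_smooth : forall phi : chart R n G, atlas phi ->
    smooth_into (chart_cod phi)
      (fun x : 'rV[R]_n => ((chart_inv phi x)^-1)%g : G)
}.

#[short(type="lieGroupType")]
HB.structure Definition LieGroup (R : realType) (n : nat) :=
  { G of SmoothManifold R n G & Group G & isLieGroup R n G }.

(* The tangent space at q is 'rV[R]_n: a tangent vector at q is given by its
   components in the preferred chart chart_at q.  The type of tangent vectors
   thus does not mention q, but the components of a vector in another chart
   are obtained through the derivative of the change of charts, and a
   function of q and of v : 'rV[R]_n is a function on the tangent bundle. *)
Section Manifold.
Context {R : realType} {n : nat} {M : smoothManifoldType R n}.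

Definition vector_field := M -> 'rV[R]_n.
Definition tangent_function := M -> 'rV[R]_n -> R.
Definition distribution := M -> {vspace 'rV[R]_n}.

(* The derivative at x of f : V -> M, a linear map into the tangent space of
   M at f x. *)
Definition diff_into (V : normedModType R) (f : V -> M) (x : V) :
    V -> 'rV[R]_n :=
  'd (chart_at (f x) \o f) x.

Definition velocity (c : R -> M) (t : R) : 'rV[R]_n := diff_into c t 1.

Definition tangent_map (f : M -> M) (q : M) : 'rV[R]_n -> 'rV[R]_n :=
  'd (chart_at (f q) \o f \o chart_inv (chart_at q)) (chart_at q q).

Definition chart_components (phi : chart R n M) (q : M) (v : 'rV[R]_n) :
    'rV[R]_n :=
  'd (phi \o chart_inv (chart_at q)) (chart_at q q) v.

(* The tangent vector at chart_inv phi x with components v in phi. *)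
Definition chart_vector (phi : chart R n M) (x v : 'rV[R]_n) : 'rV[R]_n :=
  diff_into (chart_inv phi) x v.

Definition smooth_function (f : M -> R) : Prop :=
  forall phi : chart R n M, atlas phi ->
    smooth_on (chart_cod phi) (f \o chart_inv phi).

Definition smooth_vector_field_on (U : set M) (Y : vector_field) : Prop :=
  forall phi : chart R n M, atlas phi ->
    smooth_on (chart_cod phi `&` chart_inv phi @^-1` U)
      (fun x => chart_components phi (chart_inv phi x) (Y (chart_inv phi x))).

Definition smooth_vector_field (Y : vector_field) : Prop :=
  smooth_vector_field_on setT Y.

Definition one_form (b : M -> 'rV[R]_n -> R) : Prop :=
  (forall q, scalar (b q)) /\
  (forall (phi : chart R n M) (v : 'rV[R]_n), atlas phi ->
     smooth_on (chart_cod phi)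
       (fun x => b (chart_inv phi x) (chart_vector phi x v))).

Definition riemannian_metric (m : M -> 'rV[R]_n -> 'rV[R]_n -> R) : Prop :=
  [/\ forall q v, scalar (m q v),
      forall q v w, m q v w = m q w v,
      forall q v, v != 0 -> 0 < m q v v
    & forall (phi : chart R n M) (v w : 'rV[R]_n), atlas phi ->
        smooth_on (chart_cod phi)
          (fun x => m (chart_inv phi x) (chart_vector phi x v)
                      (chart_vector phi x w))].

Definition mechanical_lagrangian (L : tangent_function) : Prop :=
  exists (m : M -> 'rV[R]_n -> 'rV[R]_n -> R) (b : M -> 'rV[R]_n -> R)
         (V : M -> R),
    [/\ riemannian_metric m, one_form b, smooth_function V
      & forall q v, L q v = 2^-1 * m q v v + b q v - V q].

Definition smooth_distribution (r : nat) (D : distribution) : Prop :=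
  (forall q, \dim (D q) = r) /\
  (forall q0 : M, exists (U : set M) (X : 'I_r -> vector_field),
     [/\ open U, U q0, forall i, smooth_vector_field_on U (X i)
       & forall q, U q -> D q = <<[seq X i q | i : 'I_r]>>%VS]).

(* Through every point passes an integral manifold, described by a local
   parametrization sigma; since D has rank r, sigma is an immersion. *)
Definition integrable (r : nat) (D : distribution) : Prop :=
  forall q : M, exists (W : set 'rV[R]_r) (sigma : 'rV[R]_r -> M),
    [/\ open W, W 0, smooth_into W sigma, sigma 0 = q
      & forall y, W y -> forall v : 'rV[R]_n,
          v \in D (sigma y) <-> exists u, v = diff_into sigma y u].

(* The constraint manifold, as a subset of each tangent space. *)
Definition constraint_manifold (Z : vector_field) (D : distribution) (q : M) :
    set 'rV[R]_n :=
  [set v | exists2 w, w \in D q & v = Z q + w].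

Record affine_nonholonomic_system (r : nat) (L : tangent_function)
    (Z : vector_field) (D : distribution) : Prop := {
  ans_lagrangian : mechanical_lagrangian L;
  ans_vector_field : smooth_vector_field Z;
  ans_rank : (1 < r < n)%N;
  ans_distribution : smooth_distribution r D;
  ans_nonintegrable : ~ integrable r D
}.

(* The derivative of L along the fibers, dL/d(qdot) in coordinates. *)
Definition momentum (L : tangent_function) (q : M) (v w : 'rV[R]_n) : R :=
  'D_w (L q) v.

Definition energy (L : tangent_function) : tangent_function :=
  fun q v => momentum L q v v - L q v.

Definition moving_energy (L : tangent_function) (Y : vector_field) :
    tangent_function :=
  fun q v => energy L q v - momentum L q v (Y q).

Definition local_lagrangian (L : tangent_function) (phi : chart R n M)
    (xv : 'rV[R]_n * 'rV[R]_n) : R :=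
  L (chart_inv phi xv.1) (chart_vector phi xv.1 xv.2).

(* F q v is the reaction force at the point v of the tangent space at q, a
   covector at q.  The equations of motion are tested on an arbitrary
   constant vector w of the coordinate space. *)
Definition equations_of_motion (L : tangent_function)
    (F : M -> 'rV[R]_n -> 'rV[R]_n -> R) (c : R -> M) (t : R) : Prop :=
  forall phi : chart R n M, atlas phi -> chart_dom phi (c t) ->
  forall w : 'rV[R]_n,
    let x : R -> 'rV[R]_n := phi \o c in
    let l := local_lagrangian L phi in
    derive1 (fun s => 'D_(0, w) l (x s, derive1 x s)) t
      - 'D_(w, 0) l (x t, derive1 x t)
      = F (c t) (velocity c t) (chart_vector phi (x t) w).

(* A motion c : I -> M of the constrained system with reaction force F. *)
Definition solution (L : tangent_function) (Z : vector_field)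
    (D : distribution) (F : M -> 'rV[R]_n -> 'rV[R]_n -> R)
    (I : set R) (c : R -> M) : Prop :=
  [/\ open I, is_interval I, smooth_into I c,
      forall t, I t -> constraint_manifold Z D (c t) (velocity c t)
    & forall t, I t -> equations_of_motion L F c t].

(* F takes values in the annihilator of D and makes the equations of motion
   a dynamics on the constraint manifold: a motion issues from every point.
   Only the values of F on the constraint manifold matter; they are
   determined by these conditions. *)
Definition reaction_force (L : tangent_function) (Z : vector_field)
    (D : distribution) (F : M -> 'rV[R]_n -> 'rV[R]_n -> R) : Prop :=
  (forall q v, constraint_manifold Z D q v ->
     scalar (F q v) /\ forall w, w \in D q -> F q v w = 0) /\
  (forall q v, constraint_manifold Z D q v ->
     exists (I : set R) (c : R -> M),
       [/\ solution L Z D F I c, I 0, c 0 = q & velocity c 0 = v]).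

Definition conserved (L : tangent_function) (Z : vector_field)
    (D : distribution) (F : M -> 'rV[R]_n -> 'rV[R]_n -> R)
    (f : tangent_function) : Prop :=
  forall (I : set R) (c : R -> M), solution L Z D F I c ->
    forall s t, I s -> I t -> f (c s) (velocity c s) = f (c t) (velocity c t).

End Manifold.

Arguments vector_field {R n} M.
Arguments tangent_function {R n} M.
Arguments distribution {R n} M.

Section LieGroup.
Context {R : realType} {n : nat} {G : lieGroupType R n}.

Definition left_translation (h : G) : G -> G := fun g => (h * g)%g.
Definition right_translation (h : G) : G -> G := fun g => (g * h)%g.

Definition left_invariant (L : tangent_function G) : Prop :=
  forall (h g : G) (v : 'rV[R]_n),
    L (left_translation h g) (tangent_map (left_translation h) g v) = L g v.

Definition right_invariant_field (Z : vector_field G) : Prop :=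
  forall h g : G,
    tangent_map (right_translation h) g (Z g) = Z (right_translation h g).

Definition right_invariant_distribution (D : distribution G) : Prop :=
  forall (g : G) (v : 'rV[R]_n),
    v \in D g <->
    exists2 u, u \in D 1%g & v = tangent_map (right_translation g) 1%g u.

Record affine_LR_system (r : nat) (L : tangent_function G)
    (Z : vector_field G) (D : distribution G) : Prop := {
  LR_nonholonomic : affine_nonholonomic_system r L Z D;
  LR_left_invariant : left_invariant L;
  LR_right_invariant_field : right_invariant_field Z;
  LR_right_invariant_distribution : right_invariant_distribution D
}.

End LieGroup.

(* Main.v *)
Require Import Defs.
From HB Require Import structures.
From mathcomp Require Import all_boot all_order all_algebra.
From mathcomp Require Import boolp classical_sets functions reals topology.
From mathcomp Require Import normedtype landau derive.
From mathcomp Require Import ring.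

(** The moving energy is constant because its derivative along a motion
    vanishes at each time t.  Work in the preferred chart at c t, and let l and
    z be the local expressions of L and Z, x the motion, v = dx/dt and
    p(w) = dl/dv . w the momentum at (x, v).  Then E_{L,Z} reads
    p(v - z(x)) - l(x, v), and differentiating it along the motion, with dp/dt
    replaced by dl/dx plus the reaction force f, leaves

      f(v - z(x)) - ( dl/dx . z(x) + dl/dv . z'(x) v ).

    The first term vanishes since v - Z lies in D and f annihilates D.  The
    second one is the derivative of L along the tangent lift of Z.  As Z is
    right-invariant, left translations generate it, and their tangent lifts
    preserve L, so this derivative vanishes too.

    The calculus above is [is_derive_moving_energy]; the vanishing of the
    derivative of l along the lift is [lift_right_invariant_components].  The
    latter does without the flow of Z.  For h near the identity,
    with coordinates y, let mu(y, x) be the product of h and the point of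
    coordinates x.  Left invariance of L says that
    l(mu(y, x), d_x mu(y, x) v) does not depend on y, whereas right invariance
    of Z says that z(x) is the derivative of mu(y, x) in y at the identity, in
    the direction Z(e) ([right_invariant_field_chart]).  Differentiating the
    first fact in y in that direction gives
    dl/dx . z(x) + dl/dv . d_y d_x mu = 0, and the symmetry of second
    derivatives ([schwarz]) turns the mixed derivative into z'(x) v. *)

Set Implicit Arguments.
Unset Strict Implicit.
Unset Printing Implicit Defensive.

Import Order.TTheory GRing.Theory Num.Theory.
Import numFieldNormedType.Exports.

Local Open Scope classical_set_scope.
Local Open Scope ring_scope.

(** * Differentials of locally equal functions and along lines *)

Section Calculus.
Context {R : realType}.
Implicit Types U V W : normedModType R.

Lemma near_translate V (P : set V) (x : V) :
  (\forall y \near x, P y) -> \forall h \near 0, P (x + h).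
Proof.
rewrite (near_shift 0)/= subr0; apply: filterS => h /=.
by rewrite addrC.
Qed.

Lemma near_eq_differentiable V W (f g : V -> W) (x : V) :
  (\forall y \near x, f y = g y) -> differentiable f x -> differentiable g x.
Proof.
move=> fg df.
have go : g \o shift x = cst (g x) + 'd f x +o_ 0 id.
  have /diff_locally/eqaddoP fo := df.
  apply/eqaddoP => e e0; have {fo} fo := fo e e0; move: fo.
  have := near_translate fg.
  apply: filter_app2; near=> h => /=; rewrite !fctE /= [h + x]addrC => ->.
  by rewrite (nbhs_singleton fg).
apply/diff_locallyP.
have gx : 'd g x = 'd f x :> (V -> W).
  by apply: diff_unique => //; exact: diff_continuous.
by rewrite gx; split => //; exact: diff_continuous.
Unshelve. all: by end_near. Qed.

Lemma near_eq_diff V W (f g : V -> W) (x : V) :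
  (\forall y \near x, f y = g y) -> differentiable f x ->
  'd f x = 'd g x :> (V -> W).
Proof.
move=> fg df; apply/funext => v.
rewrite -!deriveE//; first exact: near_eq_derive.
exact: near_eq_differentiable fg df.
Qed.

Lemma is_diff_line V (a w : V) (s : R) :
  is_diff s (fun s : R => a + s *: w) ( *:%R^~ w).
Proof.
pose L (s : R) : V := s *: w.
have [dL EL] : is_diff s L L := @is_diff_scalel R V s w.
have dc : differentiable (cst a : R -> V) s by exact: differentiable_cst.
split; first exact: (differentiableD dc dL).
rewrite -[LHS]/('d (cst a + L) s : R -> V) (diffD dc dL) diff_cst EL.
by apply/funext => r /=; exact: add0r.
Qed.

Lemma is_derive_line V W (f : V -> W) (a w : V) (s : R) :
  differentiable f (a + s *: w) ->
  is_derive s 1 (fun s : R => f (a + s *: w)) ('D_w f (a + s *: w)).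
Proof.
move=> df; have [dl El] := is_diff_line a w s.
have dfl : differentiable (fun s : R => f (a + s *: w)) s.
  by apply: (@differentiable_comp _ _ _ _ (fun s : R => a + s *: w)).
split; first exact: diff_derivable.
rewrite !deriveE// (@diff_comp _ _ _ _ (fun s : R => a + s *: w))//=.
by rewrite El scale1r.
Qed.

(** * Symmetry of second derivatives *)

Section Schwarz.
Variables (V : normedModType R) (f : V -> R) (x : V).
Hypothesis df : \forall y \near x, differentiable f y.

Definition second_difference (u v : V) (h : R) :=
  f (x + (h *: u + h *: v)) - f (x + h *: u) - f (x + h *: v) + f x.

(** The mean value theorem writes the second difference as h times an
    increment of 'D_u f over h *: v, which the differential of 'D_u f at x
    evaluates up to o(h).  The second difference being symmetric in u and v,
    its quotient by h ^+ 2 tends to both iterated derivatives. *)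
Lemma second_difference_cvg u v : differentiable ('D_u f) x ->
  (second_difference u v h / h ^+ 2) @[h --> 0^'] --> 'D_v ('D_u f) x.
Proof.
move=> dg; rewrite deriveE//; set G := 'd _ x; set g := 'D_u f.
apply/cvgrPdist_le => e e0.
have [C CE] : exists C, C = `|u| + `|v| + 1 by exists (`|u| + `|v| + 1).
have C0 : 0 < C by rewrite CE ltr_wpDl// addr_ge0.
have [d d0 Hd] : exists2 d, 0 < d & forall k, `|k| < d ->
    differentiable f (x + k) /\
    `|g (x + k) - g x - G k| <= (e / (2 * C)) * `|k|.
  have /diff_locally/eqaddoP/(_ (e / (2 * C))) := dg.
  rewrite divr_gt0 ?mulr_gt0// => /(_ isT) go.
  have : \forall k \near (0 : V), differentiable f (x + k) /\
     `|g (x + k) - g x - G k| <= (e / (2 * C)) * `|k|.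
    near=> k; split.
      by near: k; apply: (@near_translate _ (fun y => differentiable f y)).
    rewrite [x + k]addrC -addrA -opprD.
    near: k; move: go; apply: filterS => k.
    by rewrite !fctE /=.
  move=> /nbhs_normP[d /= d0 H]; exists d => // k kd.
  by apply: H; rewrite /ball_/= sub0r normrN.
near=> h.
have h0 : h != 0 by near: h; exact: nbhs_dnbhs_neq.
have hC : `|h| * C < d.
  rewrite -ltr_pdivlMr//; near: h; apply: dnbhs0_lt; exact: divr_gt0.
(* Both points where the increment of 'D_u f is taken are x plus a vector of
   norm at most `|h| * C, for every s in [0, 1]. *)
have small s : 0 <= s <= 1 -> `|h *: v + s *: (h *: u)| <= `|h| * C /\
    `|s *: (h *: u)| <= `|h| * C.
  move=> /andP[s0 s1]; rewrite CE.
  have a : `|s *: (h *: u)| <= `|h| * `|u|.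
    by rewrite normrZ [X in _ * X]normrZ ger0_norm// ler_piMl// mulr_ge0.
  split; last by apply: (le_trans a); rewrite ler_wpM2l// -addrA lerDl addr_ge0.
  apply: (le_trans (ler_normD _ _)); rewrite [X in X + _]normrZ.
  apply: (le_trans (lerD (lexx _) a)); rewrite -mulrDr ler_wpM2l//.
  by rewrite [`|v| + _]addrC lerDl.
pose phi (s : R) := f (x + h *: v + s *: (h *: u)) - f (x + s *: (h *: u)).
pose dphi (s : R) :=
  h * (g (x + h *: v + s *: (h *: u)) - g (x + s *: (h *: u))).
have Dphi (s : R) : 0 <= s <= 1 -> is_derive s 1 phi (dphi s).
  move=> s01; have [s1 s2] := small s s01.
  have [d1 _] := Hd _ (le_lt_trans s1 hC); rewrite addrA in d1.
  have [d2 _] := Hd _ (le_lt_trans s2 hC).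
  have gE y : differentiable f y -> h * g y = 'D_(h *: u) f y.
    by move=> dy; rewrite deriveE// linearZ/= /g deriveE.
  by rewrite /dphi mulrBr !gE//; apply: is_deriveB; exact: is_derive_line.
have [c cc] : exists2 c, c \in `]0%R, 1[ & phi 1 - phi 0 = dphi c * (1 - 0).
  apply: MVT => //.
    by move=> s; rewrite in_itv/= => /andP[s0 s1]; apply: Dphi; rewrite !ltW.
  apply: derivable_within_continuous => s; rewrite in_itv/= => s01.
  by have [] := Dphi s s01.
have -> : phi 1 - phi 0 = second_difference u v h.
  rewrite /phi /second_difference !scale1r !scale0r !addr0.
  by rewrite -[x + _ + _]addrA [h *: v + _]addrC opprB addrA addrAC.
rewrite subr0 mulr1 => ->; rewrite /dphi.
have c01 : 0 <= c <= 1.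
  by move: cc; rewrite in_itv/= => /andP[? ?]; rewrite !ltW.
have [s1 s2] := small c c01.
have [_ e1] := Hd _ (le_lt_trans s1 hC); rewrite addrA linearD/= in e1.
have [_ e2] := Hd _ (le_lt_trans s2 hC).
set g1 := g (x + _ + _) in e1 *.
set g2 := g (x + _) in e2 *.
(* G (c *: (h *: u)) cancels: only the two remainders of g are left. *)
have -> : G v - h * (g1 - g2) / h ^+ 2 =
    - h^-1 * ((g1 - g x - (G (h *: v) + G (c *: (h *: u)))) -
              (g2 - g x - G (c *: (h *: u)))).
  by rewrite (linearZ _ v)/= -[h *: G v]/(h * G v); field.
rewrite normrM normrN normfV ler_pdivrMl ?normr_gt0//.
apply: (le_trans (ler_normB _ _)).
apply: (le_trans (lerD e1 e2)).
have ge0 : 0 <= e / (2 * C) by rewrite divr_ge0 ?mulr_ge0 ?ltW.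
apply: (le_trans (lerD (ler_wpM2l ge0 s1) (ler_wpM2l ge0 s2))).
rewrite le_eqVlt; apply/orP; left; apply/eqP; field.
exact: lt0r_neq0.
Unshelve. all: by end_near. Qed.

Lemma schwarz_scalar u v :
  differentiable ('D_u f) x -> differentiable ('D_v f) x ->
  'D_v ('D_u f) x = 'D_u ('D_v f) x.
Proof.
move=> du dv; have cuv : _ --> 'D_v ('D_u f) x := second_difference_cvg du.
have cvu : _ --> 'D_u ('D_v f) x := second_difference_cvg dv.
have Euv : second_difference v u = second_difference u v.
  apply/funext => h; rewrite /second_difference [h *: u + _]addrC.
  by congr (_ + _); rewrite addrAC.
move: cvu; rewrite Euv => cvu.
exact: (cvg_unique _ cuv cvu).
Qed.

End Schwarz.

Lemma differentiable_entry V m (f : V -> 'rV[R]_m) (x : V) i :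
  differentiable f x -> differentiable (fun y => f y 0 i) x.
Proof.
move=> df.
apply: (@differentiable_comp _ _ _ _ f (fun N : 'rV[R]_m => N 0 i)) => //.
exact: differentiable_coord.
Qed.

Lemma derive_entry V m (f : V -> 'rV[R]_m) (x v : V) i :
  differentiable f x -> ('D_v f x) 0 i = 'D_v (fun y => f y 0 i) x.
Proof. by move=> df; rewrite derive_mx ?mxE//; exact: diff_derivable. Qed.

(** Reduced to the entries of f, since the mean value theorem behind the proof
    is about real functions. *)
Theorem schwarz V m (f : V -> 'rV[R]_m) (x u v : V) :
  (\forall y \near x, differentiable f y) ->
  differentiable ('D_u f) x -> differentiable ('D_v f) x ->
  'D_v ('D_u f) x = 'D_u ('D_v f) x.
Proof.
move=> df du dv; apply/rowP => i.
have near_entry w : \forall y \near x,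
    'D_w f y 0 i = 'D_w (fun y => f y 0 i) y.
  by apply: filterS df => y; exact: derive_entry.
apply: etrans (derive_entry v i du) _.
apply: etrans (esym (derive_entry u i dv)).
rewrite (near_eq_derive _ (near_entry u)) (near_eq_derive _ (near_entry v)).
apply: schwarz_scalar.
- by apply: filterS df => y; exact: differentiable_entry.
- apply: near_eq_differentiable (near_entry u) _; exact: differentiable_entry.
- apply: near_eq_differentiable (near_entry v) _; exact: differentiable_entry.
Qed.

End Calculus.

(** * Partial differentials *)

Lemma continuous_pairl (U V : topologicalType) (b : V) :
  continuous (fun x : U => (x, b)).
Proof. by move=> x; apply: cvg_pair; [exact: cvg_id | exact: cvg_cst]. Qed.

Lemma continuous_pairr (U V : topologicalType) (a : U) :
  continuous (fun y : V => (a, y)).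
Proof. by move=> x; apply: cvg_pair; [exact: cvg_cst | exact: cvg_id]. Qed.

Section PartialDerivative.
Context {R : realType} {U W W' : normedModType R}.

Lemma derive_snd (f : U * W -> W') (x : U) (v w : W) :
  'D_(0, w) f (x, v) = 'D_w (fun v => f (x, v)) v.
Proof.
rewrite /derive; set d := (fun _ : R => _); set d' := (fun _ : R => _).
suff -> : d = d' by []; apply/funext => h; rewrite /d /d' /=.
by rewrite -[h *: (0, w) + (x, v)]/(h *: 0 + x, h *: w + v) scaler0 add0r.
Qed.

Lemma derive_fst (f : U * W -> W') (x : U) (v : W) u :
  'D_(u, 0) f (x, v) = 'D_u (fun x => f (x, v)) x.
Proof.
rewrite /derive; set d := (fun _ : R => _); set d' := (fun _ : R => _).
suff -> : d = d' by []; apply/funext => h; rewrite /d /d' /=.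
by rewrite -[h *: (u, 0) + (x, v)]/(h *: u + x, h *: 0 + v) scaler0 add0r.
Qed.

End PartialDerivative.

Section PartialDifferential.
Context {R : realType}.
Variables (U V W : normedModType R) (f : U * V -> W) (a : U) (b : V).
Hypothesis df : differentiable f (a, b).

Let di : is_diff b (fun y : V => (a, y)) (fun v => (0, v)).
Proof.
have da : differentiable (cst a : V -> U) b by exact: differentiable_cst.
have didV : differentiable (id : V -> V) b by have [] := is_diff_id b.
split; first exact: (differentiable_pair da didV).
rewrite (diff_pair da didV) diff_cst; have [_ ->] := is_diff_id b.
by [].
Qed.

Let dj : is_diff a (fun x : U => (x, b)) (fun u => (u, 0)).
Proof.
have db : differentiable (cst b : U -> V) a by exact: differentiable_cst.
have didU : differentiable (id : U -> U) a by have [] := is_diff_id a.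
split; first exact: (differentiable_pair didU db).
rewrite (diff_pair didU db) diff_cst; have [_ ->] := is_diff_id a.
by [].
Qed.

Lemma differentiable_partial_snd : differentiable (fun y => f (a, y)) b.
Proof.
have [di1 _] := di.
exact: (@differentiable_comp _ _ _ _ (fun y : V => (a, y)) f).
Qed.

Lemma differentiable_partial_fst : differentiable (fun x => f (x, b)) a.
Proof.
have [dj1 _] := dj.
exact: (@differentiable_comp _ _ _ _ (fun x : U => (x, b)) f).
Qed.

Lemma diff_partial_snd v : 'd (fun y => f (a, y)) b v = 'D_(0, v) f (a, b).
Proof.
have [di1 di2] := di.
rewrite (@diff_comp _ _ _ _ (fun y : V => (a, y)) f)//= di2.
by rewrite deriveE.
Qed.

Lemma diff_partial_fst u : 'd (fun x => f (x, b)) a u = 'D_(u, 0) f (a, b).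
Proof.
have [dj1 dj2] := dj.
rewrite (@diff_comp _ _ _ _ (fun x : U => (x, b)) f)//= dj2.
by rewrite deriveE.
Qed.

End PartialDifferential.

(** Inserting a change of charts into a map leaves it unchanged only near the
    point under consideration, whence this form of the chain rule. *)
Lemma near_diff_comp {R : realType} (U V W : normedModType R) (f : U -> V)
    (g : V -> W) (h : U -> W) (x v : U) :
  differentiable f x -> differentiable g (f x) ->
  (\forall y \near x, h y = g (f y)) -> 'd h x v = 'd g (f x) ('d f x v).
Proof.
move=> df dg hgf; have dgf : differentiable (g \o f) x.
  exact: differentiable_comp.
have gfh : \forall y \near x, (g \o f) y = h y by apply: filterS hgf => y ->.
by rewrite -(near_eq_diff gfh dgf) (diff_comp df dg).
Qed.

(** * Pairings with a moving covector *)

Section Pairing.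
Context {R : realType} {n : nat}.
Implicit Types W : normedModType R.

Lemma scalar_sum (a : 'rV[R]_n -> R) : scalar a ->
  forall w, a w = \sum_(i < n) w 0 i * a (delta_mx 0 i).
Proof.
move=> ha w.
pose aM := GRing.isLinear.Build _ _ _ _ _ ha.
pose aL : {linear 'rV[R]_n -> R | *%R} := HB.pack a aM.
rewrite -[a]/(aL : _ -> _) {1}(row_sum_delta w) linear_sum.
by apply: eq_bigr => i _; exact: scalarZ.
Qed.

Lemma pairing_sum (W : Type) (B : W -> 'rV[R]_n -> R) (w : W -> 'rV[R]_n) :
  (forall y, scalar (B y)) ->
  (fun y => B y (w y)) =
    \sum_(i < n) ((fun y => w y 0 i) * (fun y => B y (delta_mx 0 i))).
Proof.
move=> hB; apply/funext => y; rewrite fct_sumE.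
by rewrite (scalar_sum (hB y)).
Qed.

Lemma differentiable_pairing W (B : W -> 'rV[R]_n -> R) (w : W -> 'rV[R]_n)
    (x : W) :
  (forall y, scalar (B y)) -> (forall v, differentiable (B ^~ v) x) ->
  differentiable w x -> differentiable (fun y => B y (w y)) x.
Proof.
move=> hB dB dw; rewrite pairing_sum//.
apply: differentiable_sum => i; apply: differentiableM; last exact: dB.
exact: differentiable_entry.
Qed.

(** The coordinates of w turn the pairing into a sum of products of real
    functions; the terms are regrouped after applying the product rule. *)
Lemma is_derive_pairing (A : R -> 'rV[R]_n -> R) (w : R -> 'rV[R]_n) (t : R) :
  (forall s, scalar (A s)) -> (forall v, derivable (A ^~ v) t 1) ->
  derivable w t 1 ->
  is_derive t 1 (fun s => A s (w s))
    ('D_1 (A ^~ (w t)) t + A t ('D_1 w t)).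
Proof.
move=> hA dA dw.
have dwi i : derivable (fun s => w s 0 i) t 1.
  exact: (iffLR (derivable_mxP _ _ _)).
have H : is_derive t 1 (fun s => A s (w s))
    (\sum_(i < n) (w t 0 i *: 'D_1 (A ^~ (delta_mx 0 i)) t
       + A t (delta_mx 0 i) *: 'D_1 (fun s => w s 0 i) t)).
  rewrite pairing_sum//; apply: is_derive_sum => i.
  apply: is_deriveM; exact: derivableP.
apply: is_derive_eq H _; rewrite big_split/=; congr (_ + _).
  have -> : A ^~ (w t) =
      \sum_(i < n) (w t 0 i *: (A ^~ (delta_mx 0 i))).
    by apply/funext => s; rewrite fct_sumE (scalar_sum (hA s)).
  rewrite derive_sum; last by move=> i; exact: derivableZ.
  by apply: eq_bigr => i _; rewrite deriveZ.
rewrite (scalar_sum (hA t)); apply: eq_bigr => i _.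
by rewrite derive_mx// mxE -[LHS]/(_ * _) mulrC.
Qed.

(** * Lagrangians of mechanical type on a coordinate space *)

(** The fibre derivative of a Lagrangian of mechanical type: B is the metric
    and b the gyroscopic 1-form. *)
Lemma derive_quadratic W (B : W -> W -> R) (b : W -> R) (k : R) (v w : W) :
  (forall v, scalar (B v)) -> (forall v w, B v w = B w v) -> scalar b ->
  'D_w (fun v => 2^-1 * B v v + b v - k) v = B v w + b w.
Proof.
move=> hB sB hb; apply/cvg_lim => //=.
have lB u a x y : B u (a *: x + y) = a * B u x + B u y := hB u a x y.
have lb a x y : b (a *: x + y) = a * b x + b y := hb a x y.
have : (B v w + b w) + h * (2^-1 * B w w) @[h --> 0^'] -->
    (B v w + b w) + 0 * (2^-1 * B w w).
  apply: cvgD; first exact: cvg_cst.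
  apply: cvgM; last exact: cvg_cst.
  exact: cvg_within.
rewrite mul0r addr0; apply: cvg_trans; apply: near_eq_cvg; near=> h.
have h0 : h != 0 by near: h; exact: nbhs_dnbhs_neq.
rewrite lb lB ![B (_ + _) _]sB !lB [B w v]sB -[RHS]/(_ * _).
by field.
Unshelve. all: by end_near. Qed.

Section MechanicalLagrangian.
Variables (m : 'rV[R]_n -> 'rV[R]_n -> 'rV[R]_n -> R).
Variables (b : 'rV[R]_n -> 'rV[R]_n -> R) (V : 'rV[R]_n -> R).
Variables (l : 'rV[R]_n * 'rV[R]_n -> R).
Hypothesis lE : forall x v, l (x, v) = 2^-1 * m x v v + b x v - V x.
Hypothesis m_scalar : forall x v, scalar (m x v).
Hypothesis m_sym : forall x v w, m x v w = m x w v.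
Hypothesis b_scalar : forall x, scalar (b x).
Variables (x v : 'rV[R]_n).
Hypothesis dm : forall v w, differentiable (fun x => m x v w) x.
Hypothesis db : forall v, differentiable (b ^~ v) x.
Hypothesis dV : differentiable V x.

Let D1 (f : 'rV[R]_n -> R) : differentiable f x ->
  differentiable (fun p : 'rV[R]_n * 'rV[R]_n => f p.1) (x, v).
Proof.
move=> df; apply: (@differentiable_comp _ _ _ _ fst f) => //.
by apply: linear_differentiable => p; exact: cvg_fst.
Qed.

Let D2 : differentiable (snd : 'rV[R]_n * 'rV[R]_n -> 'rV[R]_n) (x, v).
Proof. by apply: linear_differentiable => p; exact: cvg_snd. Qed.

Let Dmw w : differentiable
  (fun p : 'rV[R]_n * 'rV[R]_n => m p.1 p.2 w) (x, v).
Proof.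
have -> : (fun p : 'rV[R]_n * 'rV[R]_n => m p.1 p.2 w) =
          (fun p : 'rV[R]_n * 'rV[R]_n => m p.1 w p.2).
  by apply/funext => p; rewrite m_sym.
apply: (@differentiable_pairing _ (fun p => m p.1 w)) => //.
by move=> u; exact: (D1 (dm w u)).
Qed.

Lemma differentiable_mechanical : differentiable l (x, v).
Proof.
have -> : l = (fun p => 2^-1 *: m p.1 p.2 p.2) + (fun p => b p.1 p.2)
               - (fun p => V p.1).
  by apply/funext => -[y u]; rewrite lE.
apply: differentiableB; last exact: (D1 dV).
apply: differentiableD.
  apply: differentiableZ.
  by apply: (@differentiable_pairing _ (fun p => m p.1 p.2)).
apply: (@differentiable_pairing _ (fun p => b p.1)) => // u.
exact: (D1 (db u)).
Qed.

Lemma differentiable_fibre_derivative w : differentiable ('D_(0, w) l) (x, v).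
Proof.
have -> : 'D_(0, w) l = (fun p => m p.1 p.2 w) + (fun p => b p.1 w).
  apply/funext => -[y u]; rewrite derive_snd.
  rewrite (_ : (fun v0 => _) = (fun v => 2^-1 * m y v v + b y v - V y)).
    by rewrite derive_quadratic.
  by apply/funext => u'; rewrite lE.
by apply: differentiableD => //; exact: (D1 (db w)).
Qed.

End MechanicalLagrangian.

(** * The moving energy along a curve *)

(** [EL] is the Euler-Lagrange equation with force F.  The terms in the
    acceleration cancel as they do for the energy; what remains is the power
    of F on x' - z, zero by [F0], minus the derivative of l along the tangent
    lift of z, zero by [inv]. *)
Lemma is_derive_moving_energy (l : 'rV[R]_n * 'rV[R]_n -> R)
    (z : 'rV[R]_n -> 'rV[R]_n) (x : R -> 'rV[R]_n) (t : R)
    (F : 'rV[R]_n -> R) :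
  let x' := derive1 x in
  (\forall s \near t, differentiable l (x s, x' s)) ->
  (forall w, differentiable ('D_(0, w) l) (x t, x' t)) ->
  differentiable x t -> differentiable x' t -> differentiable z (x t) ->
  (forall w, derive1 (fun s => 'D_(0, w) l (x s, x' s)) t
             - 'D_(w, 0) l (x t, x' t) = F w) ->
  F (x' t - z (x t)) = 0 ->
  'd l (x t, x' t) (z (x t), 'd z (x t) (x' t)) = 0 ->
  is_derive t 1 (fun s => 'D_(0, x' s) l (x s, x' s) - l (x s, x' s)
                          - 'D_(0, z (x s)) l (x s, x' s)) 0.
Proof.
move=> x' dl dp dx dx' dz EL F0 inv.
pose A s w := 'd l (x s, x' s) (0, w).
pose w s := x' s - z (x s).
have hA s : scalar (A s).
  move=> a u v; rewrite /A -[RHS]/(a *: 'd l _ (0, u) + 'd l _ (0, v)) -linearP.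
  congr ('d _ _ _); by rewrite -[RHS]/(a *: 0 + 0, a *: u + v) scaler0 addr0.
have AE : \forall s \near t, forall v, 'D_(0, v) l (x s, x' s) = A s v.
  by apply: filterS dl => s ds v; rewrite deriveE.
have dpair : differentiable (fun s => (x s, x' s)) t.
  exact: differentiable_pair.
have dA v : derivable (A ^~ v) t 1.
  apply: (@near_eq_derivable _ _ _ (fun s => 'D_(0, v) l (x s, x' s))).
    by apply: filterS AE => s.
  apply/diff_derivable.
  exact: (@differentiable_comp _ _ _ _ (fun s => (x s, x' s)) ('D_(0, v) l)).
have dzx : differentiable (z \o x) t by exact: differentiable_comp.
have dw : differentiable w t by exact: differentiableB.
have w'E : 'D_1 w t = derive1 x' t - 'd z (x t) (x' t).
  rewrite /w deriveB//; try exact: diff_derivable.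
  rewrite derive1E; congr (_ - _).
  rewrite -[LHS]/('D_1 (z \o x) t) deriveE// diff_comp//=.
  by rewrite /x' derive1E deriveE.
have dw1 : derivable w t 1 by exact: diff_derivable.
have dAw := is_derive_pairing hA dA dw1.
have dlt : differentiable l (x t, x' t) by exact: nbhs_singleton dl.
have dlx : is_derive t 1 (fun s => l (x s, x' s))
    ('d l (x t, x' t) (x' t, derive1 x' t)).
  have dlp : differentiable (fun s => l (x s, x' s)) t.
    exact: (@differentiable_comp _ _ _ _ (fun s => (x s, x' s)) l).
  split; first exact: diff_derivable.
  rewrite deriveE//.
  rewrite (@diff_comp _ _ _ _ (fun s => (x s, x' s)) l)//= diff_pair//=.
  congr ('d _ _ (_, _)); first by rewrite /x' derive1E deriveE.
  by rewrite derive1E deriveE.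
have := is_deriveB dAw dlx.
move=> H; apply: is_derive_eq.
  apply: near_eq_is_derive H; apply: filterS AE => s AE.
  rewrite !AE !fctE -[LHS]/(A s (w s) - l (x s, x' s)).
  have -> : A s (w s) = A s (x' s) - A s (z (x s)).
    rewrite /w addrC -scaleN1r (hA s (-1)) /=.
    by rewrite -[*%R _ _]/(-1 * _) mulN1r addrC.
  by rewrite addrAC.
have := EL (w t); rewrite F0 => /eqP; rewrite subr_eq0 derive1E => /eqP ELw.
have -> : 'D_1 (A ^~ (w t)) t = 'd l (x t, x' t) (w t, 0).
  rewrite -deriveE// -ELw; apply/esym/near_eq_derive.
  by apply: filterS AE => s.
rewrite w'E /A -linearD -linearB/=.
rewrite -[RHS]oppr0 -inv -(linearN ('d l (x t, x' t))); congr ('d _ _ _).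
rewrite /w; congr (_, _) => /=.
  by rewrite addr0 addrAC subrr add0r.
by rewrite add0r addrAC subrr add0r.
Qed.

End Pairing.

(** * Tangent vectors in an arbitrary chart *)

Section Charts.
Context {R : realType} {n : nat} {M : smoothManifoldType R n}.
Implicit Types (phi psi : chart R n M) (q : M).

Lemma near_chart_dom (T : topologicalType) (f : T -> M) psi (x : T) :
  {for x, continuous f} -> chart_dom psi (f x) ->
  \forall y \near x, chart_dom psi (f y).
Proof.
move=> fc fx; apply: fc; apply: open_nbhs_nbhs; split => //.
exact: chart_dom_open.
Qed.

Lemma near_chart_cod phi x :
  chart_cod phi x -> \forall y \near x, chart_cod phi y.
Proof.
by move=> ?; apply: open_nbhs_nbhs; split => //; exact: chart_cod_open.
Qed.

Lemma differentiable_transition phi psi x : atlas phi -> atlas psi ->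
  chart_cod phi x -> chart_dom psi (chart_inv phi x) ->
  differentiable (psi \o chart_inv phi) x.
Proof.
move=> aphi apsi xphi xpsi.
by apply: (atlas_compatible phi psi aphi apsi [::]).
Qed.

(** Tangent vectors are recorded by their components in the preferred chart,
    so computing the image of a differential in another chart psi is the chain
    rule for the change of charts from psi to the preferred one. *)
Lemma diff_into_chart (V : normedModType R) (f : V -> M) psi (x u : V) :
  atlas psi -> {for x, continuous f} -> chart_dom psi (f x) ->
  differentiable (psi \o f) x ->
  diff_into f x u = chart_vector psi (psi (f x)) ('d (psi \o f) x u).
Proof.
move=> apsi fc fx df.
rewrite /chart_vector /diff_into chart_mapK//.
set theta := chart_at (f x).
have dt : differentiable (theta \o chart_inv psi) (psi (f x)).
  apply: differentiable_transition => //; first exact: chart_at_atlas.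
    exact: chart_map_cod.
  by rewrite chart_mapK//; exact: chart_at_dom.
apply: (@near_diff_comp _ _ _ _ (psi \o f) (theta \o chart_inv psi)) => //.
by apply: filterS (near_chart_dom fc fx) => y fy; rewrite /= chart_mapK.
Qed.

Lemma tangent_map_chart (f : M -> M) phi x v :
  let q := chart_inv phi x in
  atlas phi -> chart_cod phi x ->
  differentiable (chart_at (f q) \o f \o chart_inv (chart_at q))
                 (chart_at q q) ->
  tangent_map f q (chart_vector phi x v) = diff_into (f \o chart_inv phi) x v.
Proof.
move=> q aphi xphi df; rewrite /tangent_map /chart_vector /diff_into /= -/q.
set theta := chart_at (f q); set psi := chart_at q.
have qpsi : chart_dom psi q by exact: chart_at_dom.
have dt : differentiable (psi \o chart_inv phi) x.
  by apply: differentiable_transition => //; exact: chart_at_atlas.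
apply/esym; apply: (@near_diff_comp _ _ _ _ (psi \o chart_inv phi)
  (theta \o f \o chart_inv psi) (theta \o (f \o chart_inv phi))) => //.
have fc := chart_inv_continuous xphi.
by apply: filterS (near_chart_dom fc qpsi) => y fy; rewrite /= chart_mapK.
Qed.

End Charts.

(** * Left and right translations in charts *)

Section Multiplication.
Context {R : realType} {n : nat} {G : lieGroupType R n}.
Implicit Types (phi psi theta : chart R n G).

Definition chart_mul phi psi theta (p : 'rV[R]_n * 'rV[R]_n) : 'rV[R]_n :=
  theta (chart_inv phi p.1 * chart_inv psi p.2)%g.

Definition chart_mul_dom phi psi theta : set ('rV[R]_n * 'rV[R]_n) :=
  (chart_cod phi `*` chart_cod psi) `&`
  [set p | chart_dom theta (chart_inv phi p.1 * chart_inv psi p.2)%g].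

Lemma smooth_chart_mul phi psi theta :
  atlas phi -> atlas psi -> atlas theta ->
  smooth_on (chart_mul_dom phi psi theta) (chart_mul phi psi theta).
Proof.
move=> aphi apsi atheta; have [_ H] := mulg_smooth phi psi aphi apsi.
exact: H.
Qed.

Lemma differentiable_chart_mul phi psi theta p :
  atlas phi -> atlas psi -> atlas theta -> chart_mul_dom phi psi theta p ->
  differentiable (chart_mul phi psi theta) p.
Proof.
move=> aphi apsi atheta p_dom.
exact: (smooth_chart_mul aphi apsi atheta [::] p_dom).
Qed.

Lemma chart_mul_continuous phi psi p : atlas phi -> atlas psi ->
  chart_cod phi p.1 -> chart_cod psi p.2 ->
  {for p, continuous (fun p : 'rV[R]_n * 'rV[R]_n =>
         (chart_inv phi p.1 * chart_inv psi p.2)%g : G)}.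
Proof.
move=> aphi apsi p1 p2; have [H _] := mulg_smooth phi psi aphi apsi.
exact: H.
Qed.

Lemma near_chart_mul_dom phi psi theta p :
  atlas phi -> atlas psi -> chart_mul_dom phi psi theta p ->
  \forall p' \near p, chart_mul_dom phi psi theta p'.
Proof.
move=> aphi apsi [[p1 p2] p12]; near=> p'; split; last first.
  by near: p'; apply: (near_chart_dom (chart_mul_continuous aphi apsi p1 p2)).
near: p'; case: p p1 p2 {p12} => a b /= p1 p2.
exists (chart_cod phi, chart_cod psi) => //=.
by split => //=; exact: near_chart_cod.
Unshelve. all: by end_near. Qed.

Lemma differentiable_left_translation (h g : G) :
  differentiable (chart_at (left_translation h g) \o left_translation h
                  \o chart_inv (chart_at g)) (chart_at g g).
Proof.
have -> : chart_at (left_translation h g) \o left_translation h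
    \o chart_inv (chart_at g) = fun y => chart_mul (chart_at h) (chart_at g)
       (chart_at (left_translation h g)) (chart_at h h, y).
  apply/funext => y; rewrite /chart_mul /= chart_mapK//; exact: chart_at_dom.
apply: differentiable_partial_snd.
apply: (smooth_chart_mul _ _ _ [::]); try exact: chart_at_atlas.
split; first by split => /=; apply: chart_map_cod; exact: chart_at_dom.
by rewrite /= !chart_mapK; exact: chart_at_dom.
Qed.

(** The right-invariant field with value u at the identity, read in the chart
    phi: its value at the point g is the velocity of s |-> h(s) * g, for a curve
    h through the identity with velocity u. *)
Definition right_invariant_components (u : 'rV[R]_n) phi (x : 'rV[R]_n) :=
  'D_(u, 0) (chart_mul (chart_at 1%g) phi phi) (chart_at (1%g : G) 1%g, x).

Lemma chart_mul_dom1 phi x : chart_cod phi x ->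
  chart_mul_dom (chart_at 1%g) phi phi (chart_at (1%g : G) 1%g, x).
Proof.
move=> xphi; split.
  by split => //=; apply: chart_map_cod; exact: chart_at_dom.
by rewrite /= chart_mapK ?mul1g; [exact: chart_inv_dom|exact: chart_at_dom].
Qed.

Lemma chart_mul1 phi x : chart_cod phi x ->
  chart_mul (chart_at 1%g) phi phi (chart_at (1%g : G) 1%g, x) = x.
Proof.
move=> xphi; rewrite /chart_mul/= chart_mapK ?mul1g ?chart_invK//.
exact: chart_at_dom.
Qed.

Lemma differentiable_right_invariant_components u phi x :
  atlas phi -> chart_cod phi x ->
  differentiable (right_invariant_components u phi) x.
Proof.
move=> aphi xphi.
apply: (@differentiable_partial_snd _ _ _ _
  ('D_(u, 0) (chart_mul (chart_at 1%g) phi phi))).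
apply: (smooth_chart_mul _ _ _ [:: (u, 0)]) => //; first exact: chart_at_atlas.
exact: chart_mul_dom1.
Qed.

(** Right invariance reads Z(g) = T R_g Z(e) between the identity and g, and
    R_g is multiplication with second factor fixed. *)
Lemma right_invariant_field_chart (Z : vector_field G) phi x :
  right_invariant_field Z -> atlas phi -> chart_cod phi x ->
  Z (chart_inv phi x) =
  chart_vector phi x (right_invariant_components (Z 1%g) phi x).
Proof.
move=> ZR aphi xphi; set g := chart_inv phi x.
set y0 := chart_at (1%g : G) 1%g.
have y0K : chart_inv (chart_at 1%g) y0 = 1%g :> G.
  by rewrite chart_mapK//; exact: chart_at_dom.
have a1 : atlas (chart_at (1%g : G)) by exact: chart_at_atlas.
have y0c : chart_cod (chart_at (1%g : G)) y0.
  by apply: chart_map_cod; exact: chart_at_dom.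
have dM := differentiable_chart_mul a1 aphi aphi (chart_mul_dom1 xphi).
have gdom : chart_dom phi g by exact: chart_inv_dom.
pose f (y : 'rV[R]_n) : G := (chart_inv (chart_at 1%g) y * g)%g.
have fy0 : f y0 = g by rewrite /f y0K mul1g.
have -> : Z g = diff_into f y0 (Z 1%g).
  have Rg1 : right_translation g 1%g = g by exact: mul1g.
  by rewrite -{1}Rg1 -ZR /diff_into fy0 /tangent_map Rg1.
have fc : {for y0, continuous f}.
  have := @chart_mul_continuous _ phi (y0, x) a1 aphi y0c xphi.
  exact: (continuous_comp (@continuous_pairl _ _ x y0)).
have dphif : differentiable (phi \o f) y0.
  exact: (differentiable_partial_fst dM).
have fdom : chart_dom phi (f y0) by rewrite fy0.
rewrite (diff_into_chart (Z 1%g) aphi fc fdom dphif) fy0 chart_invK//.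
congr (chart_vector _ _ _).
by rewrite /right_invariant_components -(diff_partial_fst dM).
Qed.

(** The coordinate form of L (h g, T L_h v) = L (g, v), with y the coordinates
    of h. *)
Lemma local_lagrangian_left_translation (L : tangent_function G) phi x v y :
  left_invariant L -> atlas phi -> chart_cod phi x ->
  chart_mul_dom (chart_at 1%g) phi phi (y, x) ->
  let mu := chart_mul (chart_at 1%g) phi phi in
  local_lagrangian L phi (mu (y, x), 'D_(0, v) mu (y, x)) =
  local_lagrangian L phi (x, v).
Proof.
move=> Linv aphi xphi yx mu.
set h : G := chart_inv (chart_at 1%g) y; set g := chart_inv phi x.
have a1 : atlas (chart_at (1%g : G)) by exact: chart_at_atlas.
have dM := differentiable_chart_mul a1 aphi aphi yx.
have [[y1 x1] hg] := yx.
have muE : chart_inv phi (mu (y, x)) = left_translation h g.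
  by rewrite /mu /chart_mul/= chart_mapK.
rewrite /local_lagrangian /= muE.
rewrite -[RHS](Linv h g (chart_vector phi x v)); congr (L _ _).
rewrite tangent_map_chart//; last exact: differentiable_left_translation.
have fc : {for x, continuous (left_translation h \o chart_inv phi)}.
  have fc := @chart_mul_continuous _ phi (y, x) a1 aphi y1 x1.
  exact: (continuous_comp (@continuous_pairr _ _ y x) fc).
have df : differentiable (phi \o (left_translation h \o chart_inv phi)) x.
  exact: (differentiable_partial_snd dM).
by rewrite (diff_into_chart v aphi fc hg df) -(diff_partial_snd dM).
Qed.

(** The infinitesimal form of the left invariance of L: the expression of
    [local_lagrangian_left_translation], constant in y, is differentiated at
    the identity in the direction u. *)
Lemma lift_right_invariant_components (L : tangent_function G) u phi x v :
  left_invariant L -> atlas phi -> chart_cod phi x ->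
  differentiable (local_lagrangian L phi) (x, v) ->
  let z := right_invariant_components u phi in
  'd (local_lagrangian L phi) (x, v) (z x, 'd z x v) = 0.
Proof.
move=> Linv aphi xphi dl z.
set mu := chart_mul (chart_at 1%g) phi phi.
set y0 := chart_at (1%g : G) 1%g.
have a1 : atlas (chart_at (1%g : G)) by exact: chart_at_atlas.
have sM := smooth_chart_mul a1 aphi aphi; rewrite -/mu in sM.
have P0 : chart_mul_dom (chart_at 1%g) phi phi (y0, x) by exact: chart_mul_dom1.
have nearP := near_chart_mul_dom a1 aphi P0.
have dmu : \forall p \near (y0, x), differentiable mu p.
  by apply: filterS nearP => p; exact: (sM [::]).
have dDu := sM [:: (u, 0)] _ P0; rewrite /= in dDu.
have dDv := sM [:: (0, v)] _ P0; rewrite /= in dDv.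
have dmu0 := sM [::] _ P0; rewrite /= in dmu0.
have mu0 : mu (y0, x) = x by exact: chart_mul1.
have Dvmu0 : 'D_(0, v) mu (y0, x) = v.
  rewrite -(diff_partial_snd dmu0).
  have E : \forall y \near x, mu (y0, y) = y.
    by apply: filterS (near_chart_cod xphi) => y; exact: chart_mul1.
  rewrite (near_eq_diff E); first by have [_ ->] := is_diff_id x.
  exact: differentiable_partial_snd.
pose alpha p := (mu p, 'D_(0, v) mu p).
have alpha0 : alpha (y0, x) = (x, v) by rewrite /alpha mu0 Dvmu0.
have dalpha : differentiable alpha (y0, x) by exact: differentiable_pair.
have dl' : differentiable (local_lagrangian L phi) (alpha (y0, x)).
  by rewrite alpha0.
have <- : 'D_(u, 0) (local_lagrangian L phi \o alpha) (y0, x) = 0.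
  rewrite derive_fst -(derive_cst (local_lagrangian L phi (x, v)) y0 u).
  apply: near_eq_derive.
  have : \forall y \near y0, chart_mul_dom (chart_at 1%g) phi phi (y, x).
    exact: (@continuous_pairl _ _ x y0).
  apply: filterS => y yx.
  exact: local_lagrangian_left_translation.
have dla : differentiable (local_lagrangian L phi \o alpha) (y0, x).
  exact: differentiable_comp.
have alphaE : 'd alpha (y0, x) (u, 0) = (z x, 'd z x v).
  rewrite /alpha (diff_pair dmu0 dDv); congr (_, _).
    by rewrite -(deriveE _ dmu0).
  rewrite /z (diff_partial_snd dDu) -(deriveE _ dDv).
  exact: (schwarz dmu dDv dDu).
rewrite (deriveE _ dla) -alphaE -alpha0; apply/esym.
apply: near_diff_comp => //; exact: filterE.
Qed.

End Multiplication.

(** * Conservation *)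

Lemma is_derive_0_constant {R : realType} (f : R -> R) (I : set R) :
  is_interval I -> (forall t, I t -> is_derive t 1 f 0) ->
  forall s t, I s -> I t -> f s = f t.
Proof.
move=> iI df; suff lt_case s t : I s -> I t -> s < t -> f s = f t.
  by move=> s t Is It; have [/lt_case->|/lt_case->|->] := ltgtP s t.
move=> Is It st.
have df' x : x \in `[s, t] -> is_derive x 1 f 0.
  by rewrite in_itv/= => sxt; apply: df; apply: iI Is It _ sxt.
have f_cont : {within `[s, t], continuous f}.
  by apply: derivable_within_continuous => x /df' [].
have f_der x : x \in `]s, t[ -> is_derive x 1 f ((fun=> 0) x).
  by move=> xst; apply: df'; exact: subset_itv_oo_cc.
have [c _] := MVT st f_der f_cont.
by rewrite mul0r => /eqP; rewrite subr_eq0 => /eqP.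
Qed.

Section LocalLagrangian.
Context {R : realType} {n : nat} {M : smoothManifoldType R n}.
Variables (L : tangent_function M) (phi : chart R n M).

(** The momentum is defined in the preferred chart; being the derivative of L
    along a fibre, it only depends on the linear structure of the fibre, and
    hence is computed by any chart. *)
Lemma momentum_chart x v w :
  momentum L (chart_inv phi x) (chart_vector phi x v) (chart_vector phi x w) =
  'D_(0, w) (local_lagrangian L phi) (x, v).
Proof.
rewrite derive_snd /momentum /derive.
set d := (fun _ : R => _); set d' := (fun _ : R => _).
suff -> : d = d' by []; apply/funext => h; rewrite /d /d' /local_lagrangian /=.
by rewrite /chart_vector /diff_into linearP.
Qed.

(** A chart identifies the fibres linearly with the coordinate space, so that L
    keeps its mechanical form, the components of the metric, of the 1-form and
    of the potential being smooth functions of the coordinates. *)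
Lemma local_lagrangian_regular x v :
  mechanical_lagrangian L -> atlas phi -> chart_cod phi x ->
  differentiable (local_lagrangian L phi) (x, v) /\
  forall w, differentiable ('D_(0, w) (local_lagrangian L phi)) (x, v).
Proof.
move=> [m [b [V [[mlin msym _ msm] [blin bsm] Vsm LE]]]] aphi xphi.
pose A y w := chart_vector phi y w.
have AP y a u w : A y (a *: u + w) = a *: A y u + A y w.
  by rewrite /A /chart_vector /diff_into linearP.
pose mc y u w := m (chart_inv phi y) (A y u) (A y w).
pose bc y w := b (chart_inv phi y) (A y w).
have lE y w : local_lagrangian L phi (y, w) =
    2^-1 * mc y w w + bc y w - (V \o chart_inv phi) y.
  by rewrite /local_lagrangian LE.
have mcs y u : scalar (mc y u) by move=> a w1 w2; rewrite /mc AP mlin.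
have mcsym y u w : mc y u w = mc y w u by rewrite /mc msym.
have bcs y : scalar (bc y) by move=> a w1 w2; rewrite /bc AP blin.
have dm u w : differentiable (fun y => mc y u w) x.
  exact: (msm phi u w aphi [::] x xphi).
have db w : differentiable (bc ^~ w) x by exact: (bsm phi w aphi [::] x xphi).
have dV : differentiable (V \o chart_inv phi) x.
  exact: (Vsm phi aphi [::] x xphi).
split; first exact: (differentiable_mechanical lE).
by move=> w; exact: (differentiable_fibre_derivative lE).
Qed.

End LocalLagrangian.

Section MovingEnergy.
Context {R : realType} {n : nat} {G : lieGroupType R n}.

(** Near t the motion stays in the domain of the preferred chart at c t, where
    [is_derive_moving_energy] applies. *)
Lemma moving_energy_stationary (r : nat) (L : tangent_function G)
    (Z : vector_field G) (D : distribution G)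
    (F : G -> 'rV[R]_n -> 'rV[R]_n -> R) (I : set R) (c : R -> G) (t : R) :
  affine_LR_system r L Z D -> reaction_force L Z D F ->
  solution L Z D F I c -> I t ->
  is_derive t 1 (fun s => moving_energy L Z (c s) (velocity c s)) 0.
Proof.
move=> [[Lmech _ _ _ _] Linv ZR _] [Fann _] [Io _ [cc csm] cM cEL] It.
set phi := chart_at (c t).
have aphi : atlas phi by exact: chart_at_atlas.
pose x := phi \o c.
pose z := right_invariant_components (Z 1%g) phi.
set l := local_lagrangian L phi.
have nearI : \forall s \near t, I s by exact: open_nbhs_nbhs.
have ndom : \forall s \near t, chart_dom phi (c s).
  by apply: near_chart_dom; [exact: cc | exact: chart_at_dom].
have xsm vs s : I s -> chart_dom phi (c s) ->
    differentiable (foldr (fun v g y => 'D_v g y) x vs) s.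
  by move=> Is cs; apply: csm.
have x'E : derive1 x = 'D_1 x by apply/funext => s; rewrite derive1E.
have velE s : I s -> chart_dom phi (c s) ->
    velocity c s = chart_vector phi (x s) (derive1 x s).
  move=> Is cs; have dx := xsm [::] s Is cs.
  rewrite /velocity (diff_into_chart _ aphi (cc _ Is) cs dx).
  by rewrite derive1E (deriveE _ dx).
have ZE s : chart_dom phi (c s) -> Z (c s) = chart_vector phi (x s) (z (x s)).
  move=> cs; rewrite -{1}(chart_mapK cs).
  apply: right_invariant_field_chart => //; exact: chart_map_cod.
have EE : \forall s \near t,
    'D_(0, derive1 x s) l (x s, derive1 x s) - l (x s, derive1 x s)
    - 'D_(0, z (x s)) l (x s, derive1 x s)
    = moving_energy L Z (c s) (velocity c s).
  near=> s.
  have Is : I s by near: s.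
  have cs : chart_dom phi (c s) by near: s.
  rewrite /moving_energy /energy velE// ZE// /l -!momentum_chart.
  by rewrite /local_lagrangian /= /x /= !chart_mapK.
have ct : chart_dom phi (c t) by exact: chart_at_dom.
have xt : chart_cod phi (x t) by exact: chart_map_cod.
have reg y v := @local_lagrangian_regular _ _ _ L phi y v Lmech aphi.
apply: near_eq_is_derive EE _.
apply: (@is_derive_moving_energy _ _ l z x t
  (fun w => F (c t) (velocity c t) (chart_vector phi (x t) w))).
- near=> s; apply: (reg _ _ _).1; apply: chart_map_cod; near: s; exact: ndom.
- by move=> w; apply: (reg _ _ _).2.
- exact: (xsm [::] t It ct).
- by rewrite x'E; exact: (xsm [:: 1] t It ct).
- exact: differentiable_right_invariant_components.
- by move=> w; exact: (cEL t It phi aphi ct w).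
- have [_] := Fann _ _ (cM t It); apply.
  have [w wD vE] := cM t It.
  have -> : chart_vector phi (x t) (derive1 x t - z (x t)) =
      velocity c t - Z (c t).
    by rewrite (velE t It ct) (ZE t ct) /chart_vector /diff_into linearB.
  by rewrite vE addrAC subrr add0r.
- exact: (lift_right_invariant_components (Z 1%g) Linv aphi xt (reg _ _ xt).1).
Unshelve. all: by end_near. Qed.

End MovingEnergy.

Theorem corollary13 (R : realType) (n r : nat) (G : lieGroupType R n)
    (L : tangent_function G) (Z : vector_field G) (D : distribution G)
    (F : G -> 'rV[R]_n -> 'rV[R]_n -> R) :
  affine_LR_system r L Z D ->
  reaction_force L Z D F ->
  conserved L Z D F (moving_energy L Z).
Proof.
move=> LR RF I c sol; have [_ iI _ _ _] := sol.
apply: is_derive_0_constant iI _ => t It.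
exact: moving_energy_stationary LR RF sol It.
Qed.
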